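(* Let $s\ge 1$ and $f\in\ell(\mathbb{Z}^s)$. If $\operatorname{rank} H(f)<\infty$, then $$\operatorname{rank} H_k(f) = \operatorname{rank} H_{\Upsilon_k,\Upsilon_k}(f) = \operatorname{rank} H(f)\qquad\text{for all integers } k\ge\operatorname{rank} H(f).$$
   Context: $\mathbb{N}_0 = \{0,1,2,\dots\}$ and $\ell(\mathbb{Z}^s)$ is the complex vector space of all functions (sequences) $f:\mathbb{Z}^s\to\mathbb{C}$. For finite sets $A,B\subset\mathbb{Z}^s$ the Hankel matrix of $f$ is $H_{A,B}(f) = \big(f(\alpha+\beta)\big)_{\alpha\in A,\ \beta\in B}\in\mathbb{C}^{A\times B}$, and the rank of the Hankel operator $H(f)$ is $\operatorname{rank} H(f) = \sup\{\operatorname{rank} H_{A,B}(f) : A,B\subset\mathbb{Z}^s \text{ finite}\}\in\mathbb{N}_0\cup\{\infty\}$. Moreover $\Gamma_k = \{\alpha\in\mathbb{N}_0^s : |\alpha|\le k\}$ with $|\alpha| = \alpha_1+\dots+\alpha_s$, $H_k(f) = H_{\Gamma_k,\Gamma_k}(f)$, and $\Upsilon_k = \{\alpha\in\mathbb{N}_0^s : \prod_{j=1}^s(1+\alpha_j)\le k\}$ is the positive part of the hyperbolic cross. *)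

(* Defs.v *)
From mathcomp Require Import all_boot all_order all_algebra.
From mathcomp Require Import finmap complex.
From mathcomp Require Import all_classical all_reals ereal.

Set Implicit Arguments.
Unset Strict Implicit.
Unset Printing Implicit Defensive.

Import Order.TTheory GRing.Theory Num.Theory.

Local Open Scope ring_scope.

(* Z^s, with its pointwise additive group structure. *)
Notation lattice s := {ffun 'I_s -> int}.

(* The rows of H_{A,B}(f) are indexed by the canonical enumeration of A, the
   columns by that of B; the rank does not depend on this choice of order. *)
Definition hankel (R : realType) (s : nat) (A B : {fset lattice s})
    (f : lattice s -> R[i]) : 'M[R[i]]_(#|{: A}|, #|{: B}|) :=
  \matrix_(i, j) f (val (enum_val i) + val (enum_val j)).

(* The supremum is taken in the extended reals: it is a natural number when the
   ranks are bounded, and +oo otherwise. *)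
Definition hankel_rank (R : realType) (s : nat) (f : lattice s -> R[i])
    : \bar R :=
  ereal_sup [set ((\rank (hankel A B f))%:R)%:E |
             A in [set: {fset lattice s}] & B in [set: {fset lattice s}]].

Definition nat_point (s k : nat) (a : {ffun 'I_s -> 'I_k}) : lattice s :=
  [ffun j => (a j)%:Z].

(* In Gamma_k and Upsilon_k every coordinate is at most k, so that both sets
   are obtained by filtering {0, ..., k}^s; in_Gamma and in_Upsilon give the
   characterizations inside Z^s. *)
Definition Gamma (s k : nat) : {fset lattice s} :=
  [fset nat_point a | a in [pred a : {ffun 'I_s -> 'I_k.+1} |
                            (\sum_(j < s) a j <= k)%N]]%fset.

Definition Upsilon (s k : nat) : {fset lattice s} :=
  [fset nat_point a | a in [pred a : {ffun 'I_s -> 'I_k.+1} |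
                            (\prod_(j < s) (1 + a j) <= k)%N]]%fset.

Lemma in_Gamma (s k : nat) (x : lattice s) :
  x \in Gamma s k = [forall j, 0 <= x j] && (\sum_(j < s) x j <= k%:Z).
Proof.
apply/imfsetP/andP => [[a /= + ->]|[/forallP x0 xk]].
  move=> ak; split; first by apply/forallP => j; rewrite ffunE.
  rewrite (eq_bigr (fun j => (a j)%:Z)) => [|j _]; last by rewrite ffunE.
  by rewrite -(big_morph Posz PoszD (erefl 0%:Z)) lez_nat.
have xE j : x j = `|x j|%N%:Z by rewrite gez0_abs.
move: xk; rewrite (eq_bigr (fun j => `|x j|%N%:Z)) => [|j _]; last exact: xE.
rewrite -(big_morph Posz PoszD (erefl 0%:Z)) lez_nat => xk.
have xlt j : (`|x j| < k.+1)%N.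
  by rewrite ltnS (leq_trans _ xk)// (bigD1 j)//= leq_addr.
exists [ffun j => Ordinal (xlt j)]; last first.
  by apply/ffunP => j; rewrite !ffunE /= -xE.
by rewrite /in_mem /=; under eq_bigr do rewrite ffunE.
Qed.

Lemma in_Upsilon (s k : nat) (x : lattice s) :
  x \in Upsilon s k = [forall j, 0 <= x j] && (\prod_(j < s) (1 + x j) <= k%:Z).
Proof.
apply/imfsetP/andP => [[a /= + ->]|[/forallP x0 xk]].
  move=> ak; split; first by apply/forallP => j; rewrite ffunE.
  rewrite (eq_bigr (fun j => (1 + a j)%N%:Z)) => [|j _]; last first.
    by rewrite ffunE PoszD.
  by rewrite -(big_morph Posz PoszM (erefl 1%:Z)) lez_nat.
have xE j : x j = `|x j|%N%:Z by rewrite gez0_abs.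
move: xk; rewrite (eq_bigr (fun j => (1 + `|x j|)%N%:Z)) => [|j _]; last first.
  by rewrite PoszD -xE.
rewrite -(big_morph Posz PoszM (erefl 1%:Z)) lez_nat => xk.
have xlt j : (`|x j| < k.+1)%N.
  rewrite ltnS (leq_trans _ xk)// (bigD1 j)//=.
  by rewrite (leq_trans (leq_addl 1 _))// leq_pmulr// prodn_gt0.
exists [ffun j => Ordinal (xlt j)]; last first.
  by apply/ffunP => j; rewrite !ffunE /= -xE.
by rewrite /in_mem /=; under eq_bigr do rewrite ffunE.
Qed.

(* Main.v *)
Require Import Defs.
From mathcomp Require Import all_boot all_order all_algebra.
From mathcomp Require Import finmap complex.
From mathcomp Require Import all_classical all_reals ereal.
From mathcomp Require mpoly.
Import -(notations) mpoly.

(** Let r be the rank of H(f). Some finite section of H(f) has rank r, and it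
contains an invertible r x r matrix H(p, q) = (f(p_i + q_j)). As no section has
a larger rank, the Schur complement formula expresses every other section
through H(p, q) (point_hankelE):
  H(p', q') = H(p', q) H(p, q)^-1 H(p, q').
Hence the vector u(x) = (f(x + q_j))_j of length r determines the whole
translate f(x + .), and a linear relation between finitely many vectors u(g_i)
persists when all the g_i are translated by the same y (hankel_row_shift).
Up to a linear isomorphism, u(x) is the class of the monomial X^x in the
r-dimensional algebra C[Z^s]/I, where I is the ideal of difference operators annihilating f.

It suffices that the u(x) with x in Upsilon_k span the whole space when k >= r:
applied to q and, since H(f) is symmetric, to p, this makes the outer factors
of the formula for H_{A,A}(f) of rank r as soon as A contains Upsilon_k, and
Gamma_k does.

The spanning property rests on one device (extremal_relation): more than r
vectors u(g_i) are dependent, and solving a relation for its largest term in a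
given order writes u(g_i + y), for that term and for all y, through the smaller
ones.
- If a in N_0^s is not in Upsilon_k, the box of the b <= a has
  prod (1 + a_j) > k >= r elements. For a monomial order, translating the
  relation so that its leading term becomes a rewrites u(a) with smaller
  exponents in N_0^s; well-founded induction ends in Upsilon_k
  (mnm_hankel_row_sub).
- For x in Z^s, take y in N_0^s with x + y >= 0. The relation between
  u(x), u(x + y), ..., u(x + r y), solved for the smallest multiple of y that
  occurs, rewrites u(x) with points x + n y, n >= 1, all in N_0^s
  (hankel_row_sub). *)

Set Implicit Arguments.
Unset Strict Implicit.
Unset Printing Implicit Defensive.

Import Order.TTheory GRing.Theory Num.Theory.

Local Open Scope ring_scope.

(** * Linear algebra *)

Lemma mxrank_mxsub (K : fieldType) (m n m' n' : nat) (g : 'I_m' -> 'I_m)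
    (h : 'I_n' -> 'I_n) (A : 'M[K]_(m, n)) :
  (\rank (mxsub g h A) <= \rank A)%N.
Proof.
have rank_rowsub m1 m2 n1 (e : 'I_m2 -> 'I_m1) (B : 'M[K]_(m1, n1)) :
    (\rank (rowsub e B) <= \rank B)%N by rewrite mxrankS ?rowsub_sub.
have -> : mxsub g h A = rowsub g (rowsub h A^T)^T.
  by apply/matrixP => i j; rewrite !mxE.
apply: leq_trans (rank_rowsub _ _ _ _ _) _.
by rewrite mxrank_tr -[leqRHS]mxrank_tr.
Qed.

Lemma unit_mxsub_rank (K : fieldType) (m n : nat) (A : 'M[K]_(m, n)) :
  exists g h, mxsub g h A \in @unitmx K (\rank A).
Proof.
pose B := rowsub (maxrankfun A) A.
have B_full : row_full B^T.
  by rewrite /row_full mxrank_tr -/(row_free B) maxrowsub_free.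
exists (maxrankfun A), (fullrankfun B_full).
rewrite -unitmx_tr.
suff -> : (mxsub (maxrankfun A) (fullrankfun B_full) A)^T =
    rowsub (fullrankfun B_full) B^T.
  exact: fullrowsub_unit.
by apply/matrixP => i j; rewrite !mxE.
Qed.

(** The rows of (A b) are already independent, so that a bordered matrix of rank
at most r has no row outside their span: the Schur complement vanishes. *)
Lemma schur_rank (K : fieldType) (r m n : nat) (A : 'M[K]_r) (b : 'M_(r, n))
    (c : 'M_(m, r)) (d : 'M_(m, n)) :
  A \in unitmx -> (\rank (block_mx A b c d) <= r)%N -> d = c *m invmx A *m b.
Proof.
move=> A_unit; rewrite block_mxEv => rank_le.
have top_free : row_free (row_mx A b).
  apply/row_freeP; exists (col_mx (invmx A) 0).
  by rewrite mul_row_col mulmx0 addr0 mulmxV.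
have le_top : (row_mx A b <= col_mx (row_mx A b) (row_mx c d))%MS.
  by rewrite -addsmxE addsmxSl.
have : (col_mx (row_mx A b) (row_mx c d) <= row_mx A b)%MS.
  by rewrite -(geq_leqif (mxrank_leqif_sup le_top)) (eqP top_free).
rewrite col_mx_sub => /andP[_ /submxP[w]].
by rewrite mul_mx_row => /eq_row_mx[-> ->]; rewrite mulmxK.
Qed.

(** * Hankel matrices along finite families of points *)

Section PointHankel.
Variables (K : fieldType) (s : nat) (f : lattice s -> K).

Definition point_hankel (m n : nat) (p : 'I_m -> lattice s)
    (q : 'I_n -> lattice s) : 'M[K]_(m, n) := \matrix_(i, j) f (p i + q j).

(** This is u(x): the translate of f by x, sampled at the points q. *)
Definition hankel_row (n : nat) (q : 'I_n -> lattice s) (x : lattice s) :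
  'rV[K]_n := \row_j f (x + q j).

Lemma row_point_hankel m n (p : 'I_m -> lattice s) (q : 'I_n -> lattice s) i :
  row i (point_hankel p q) = hankel_row q (p i).
Proof. by apply/rowP => j; rewrite !mxE. Qed.

Lemma tr_point_hankel m n (p : 'I_m -> lattice s) (q : 'I_n -> lattice s) :
  (point_hankel p q)^T = point_hankel q p.
Proof. by apply/matrixP => i j; rewrite !mxE addrC. Qed.

Variables (r : nat) (p q : 'I_r -> lattice s).
Hypothesis pq_unit : point_hankel p q \in unitmx.
Hypothesis rank_le : forall m n (p' : 'I_m -> lattice s) (q' : 'I_n -> lattice s),
  (\rank (point_hankel p' q') <= r)%N.

(** The section along the concatenations of p with p' and of q with q' is
bordered by H(p, q) and has rank at most r. *)
Lemma point_hankelE m n (p' : 'I_m -> lattice s) (q' : 'I_n -> lattice s) :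
  point_hankel p' q' =
    point_hankel p' q *m invmx (point_hankel p q) *m point_hankel p q'.
Proof.
apply: schur_rank => //.
pose cat n1 n2 (a : 'I_n1 -> lattice s) (b : 'I_n2 -> lattice s)
    (i : 'I_(n1 + n2)) :=
  match fintype.split i with inl j => a j | inr j => b j end.
apply: leq_trans (rank_le (cat _ _ p p') (cat _ _ q q')).
rewrite (_ : block_mx _ _ _ _ = point_hankel (cat _ _ p p') (cat _ _ q q')) //.
apply/matrixP => i j; rewrite !mxE /cat.
by case: (fintype.split i) => ?; rewrite !mxE;
  case: (fintype.split j) => ?; rewrite !mxE.
Qed.

(** The j-th entry of u(x + y) is f(x + (y + q_j)), and by point_hankelE such
values depend on x through u(x) only, linearly. *)
Lemma hankel_row_shift (I : finType) (c : I -> K) (g : I -> lattice s) y :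
  \sum_i c i *: hankel_row q (g i) = 0 ->
  \sum_i c i *: hankel_row q (g i + y) = 0.
Proof.
move=> rel0.
have rowE (q' : 'I_r -> lattice s) x :
    hankel_row q' x =
      hankel_row q x *m (invmx (point_hankel p q) *m point_hankel p q').
  have := row_point_hankel (fun=> x) q' (ord0 : 'I_1).
  by rewrite point_hankelE -mulmxA row_mul row_point_hankel => <-.
have shiftE x : hankel_row q (x + y) = hankel_row (fun j => y + q j) x.
  by apply/rowP => j; rewrite !mxE addrA.
under eq_bigr do rewrite shiftE rowE scalemxAl.
by rewrite -mulmx_suml rel0 mul0mx.
Qed.

(** The leading term of a linear relation under the order w; by shift
invariance the same coefficients serve for all y. *)
Lemma extremal_relation d (T : orderType d) (I : finType) (w : I -> T)
    (g : I -> lattice s) :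
  injective w -> (r < #|I|)%N ->
  exists i0, exists c : I -> K, forall y,
    hankel_row q (g i0 + y) =
      \sum_(i | (w i < w i0)%O) c i *: hankel_row q (g i + y).
Proof.
move=> w_inj r_lt.
pose U := \matrix_(i < #|I|) hankel_row q (g (enum_val i)).
have : kermx U != 0.
  by rewrite kermx_eq0 /row_free neq_ltn (leq_ltn_trans (rank_leq_col U)).
case/rowV0Pn => z /sub_kermxP zU0 z_neq0.
pose c i : K := z 0 (enum_rank i).
have rel0 : \sum_i c i *: hankel_row q (g i) = 0.
  rewrite -[RHS]zU0 mulmx_sum_row (reindex (@enum_val I predT)) /=; last first.
    exact: onW_bij (@enum_val_bij I).
  by apply: eq_bigr => i _; rewrite rowK /c enum_valK.
have [j cj] : exists j, c j != 0.
  have [l zl] := rV0Pn _ z_neq0.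
  by exists (enum_val l); rewrite /c enum_valK.
case: (arg_maxP w (cj : [pred i | c i != 0] j)) => i0 /= ci0 i0_max.
exists i0, (fun i => - (c i0)^-1 * c i) => y.
have := hankel_row_shift y rel0.
rewrite (bigD1 i0) //= (bigID (fun i => (w i < w i0)%O)) /=.
rewrite [X in _ + (_ + X)]big1 ?addr0; last first.
  move=> i /andP[i_neq]; rewrite -leNgt => le_i0.
  have [->|ci] := eqVneq (c i) 0; first by rewrite scale0r.
  by case/eqP: i_neq; apply: w_inj; apply: le_anti; rewrite le_i0 i0_max.
move/eqP; rewrite addr_eq0 => /eqP E.
rewrite -[LHS](scalerK ci0) E scalerN -scaleNr scaler_sumr.
apply: eq_big => [i|i _]; last by rewrite scalerA.
by case: (eqVneq i i0) => [->|//]; rewrite ltxx.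
Qed.

(** * Reduction to the hyperbolic cross *)

(** Exponents in N_0^s are taken as multinomials for the sake of their monomial
order, which is compatible with addition and well-founded. *)
Definition mnm_point (a : multinom s) : lattice s := [ffun j => (a j)%:Z].

Lemma mnm_pointD a b : mnm_point (mnm_add a b) = mnm_point a + mnm_point b.
Proof. by apply/ffunP => j; rewrite !ffunE mnmDE. Qed.

Lemma mnm_point_abs (x : lattice s) :
  (forall j, 0 <= x j) ->
  mnm_point (mpoly.Multinom [tuple `|x j|%N | j < s]) = x.
Proof.
by move=> x0; apply/ffunP => j; rewrite ffunE multinomE tnth_mktuple gez0_abs.
Qed.

Lemma mnm_point_Upsilon k a :
  (mnm_point a \in Upsilon s k) = (\prod_(j < s) (a j).+1 <= k)%N.
Proof.
rewrite in_Upsilon; have -> : [forall j, 0 <= mnm_point a j].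
  by apply/forallP => j; rewrite ffunE.
rewrite (eq_bigr (fun j => (a j).+1%:Z)) => [|j _]; last by rewrite ffunE.
by rewrite -(big_morph Posz PoszM (erefl 1%:Z)) lez_nat.
Qed.

Variables (k m : nat) (W : 'M[K]_(m, r)).
Hypothesis r_le_k : (r <= k)%N.
Hypothesis Upsilon_sub : {in Upsilon s k, forall x, (hankel_row q x <= W)%MS}.

(** Outside Upsilon_k the box below a has more than k >= r elements, hence a
relation; as its leading exponent w b lies in that box, translating it by a - w b
keeps all exponents in N_0^s and turns the leading one into a. *)
Lemma mnm_hankel_row_sub a : (hankel_row q (mnm_point a) <= W)%MS.
Proof.
elim/(@ltmwf s): a => a IH.
have [a_in|a_out] := boolP (mnm_point a \in Upsilon s k); first exact: Upsilon_sub.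
pose box := {dffun forall j : 'I_s, 'I_(a j).+1}.
pose w (b : box) : multinom s := mpoly.Multinom [tuple b j : nat | j < s].
have wE b j : w b j = b j by rewrite multinomE tnth_mktuple.
have w_inj : injective w.
  by move=> b b' eq_w; apply/ffunP => j; apply: val_inj; rewrite /= -!wE eq_w.
have box_gt : (r < #|{: box}|)%N.
  rewrite card_dep_ffun foldrE big_map big_enum /=.
  under eq_bigr do rewrite card_ord.
  by rewrite (leq_ltn_trans r_le_k) // ltnNge -mnm_point_Upsilon.
have [b [c rel]] := extremal_relation (mnm_point \o w) w_inj box_gt.
have split_a : mnm_add (w b) (mnm_sub a (w b)) = a.
  by apply/mnmP => j; rewrite mnmDE mnmBE subnKC // wE -ltnS.
rewrite -split_a mnm_pointD rel summx_sub // => i lt_i; rewrite scalemx_sub //=.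
by rewrite -mnm_pointD IH // -{2}split_a ltmc_add2l.
Qed.

(** The negative coordinates are reached by the relation between the points
x + n y, 0 <= n <= r, with y = |x|, solved for the least n that occurs. *)
Lemma hankel_row_sub x : (hankel_row q x <= W)%MS.
Proof.
pose y : lattice s := [ffun j => `|x j|].
(* The multiples of y decrease with i: the largest index in the relation is
   the smallest multiple. *)
pose g (i : 'I_r.+1) := x + y *+ (r - i)%N.
have [|i0 [c rel]] := extremal_relation g (@inj_id 'I_r.+1).
  by rewrite card_ord.
have := rel (- (y *+ (r - i0)%N)).
rewrite /g addrK => ->; apply: summx_sub => i lt_i; apply: scalemx_sub.
have {}lt_i : (i < i0)%N by [].
rewrite -addrA -mulrnBr ?leq_sub2l ?(ltnW lt_i) //.
set z := x + _; rewrite -[z]mnm_point_abs ?mnm_hankel_row_sub // => j.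
have : (0 < r - i - (r - i0))%N.
  by rewrite subn_gt0 ltn_sub2l // (leq_trans lt_i) // -ltnS.
case: (r - i - (r - i0))%N @z => // n z _.
rewrite !ffunE ffunMnE ffunE mulrS addrA addr_ge0 ?mulrn_wge0 //.
by rewrite -lerBlDl sub0r -normrN ler_norm.
Qed.

Lemma Upsilon_row_full : row_full W.
Proof.
rewrite -sub1mx -(mulVmx pq_unit); apply: mulmx_sub.
by apply/row_subP => i; rewrite row_point_hankel hankel_row_sub.
Qed.

End PointHankel.

(** * Hankel matrices on finite subsets of the lattice *)

Lemma Upsilon_sub_Gamma (s k : nat) : {subset Upsilon s k <= Gamma s k}.
Proof.
move=> x; rewrite in_Upsilon in_Gamma => /andP[/forallP x0 x_le].
apply/andP; split; first exact/forallP.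
apply: le_trans x_le.
(* The induction needs the product to be at least 1, which follows from the
   bound itself once the sum is known to be nonnegative. *)
have [_] : 0 <= \sum_(j < s) x j /\
    1 + \sum_(j < s) x j <= \prod_(j < s) (1 + x j).
  elim/big_rec2: _ => // j P S _ [S0 SP]; split; first exact: addr_ge0.
  rewrite mulrDl mul1r addrCA addrC lerD // ler_peMr //.
  by apply: le_trans SP; rewrite lerDl.
by apply: le_trans; rewrite lerDr.
Qed.

Lemma le_hankel_rank (R : realType) (s : nat) (f : lattice s -> R[i]) A B :
  (((\rank (hankel A B f))%:R)%:E <= hankel_rank f)%E.
Proof. by apply: ereal_sup_ubound; exists A => //; exists B. Qed.

Definition fset_point (s : nat) (A : {fset lattice s}) (i : 'I_#|{: A}|) :
  lattice s := val (enum_val i).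

Lemma hankelE (R : realType) (s : nat) (f : lattice s -> R[i]) A B :
  hankel A B f = point_hankel f (@fset_point s A) (@fset_point s B).
Proof. by []. Qed.

(** Sections along families, possibly with repetitions, have no larger rank
than those along finite sets. *)
Lemma point_hankel_mxsub (R : realType) (s : nat) (f : lattice s -> R[i]) m n
    (p : 'I_m -> lattice s) (q : 'I_n -> lattice s) :
  exists A B g h, point_hankel f p q = mxsub g h (hankel A B f).
Proof.
have inP n' (t : 'I_n' -> lattice s) i : t i \in [fset t j | j in 'I_n']%fset.
  exact: in_imfset.
exists _, _, (fun i => enum_rank [` inP _ p i]%fset),
  (fun j => enum_rank [` inP _ q j]%fset).
by apply/matrixP => i j; rewrite !mxE !enum_rankK.
Qed.

(** The supremum of a bounded set of natural numbers is a maximum. *)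
Lemma hankel_rank_attained (R : realType) (s : nat) (f : lattice s -> R[i]) k :
  (hankel_rank f <= (k%:R)%:E)%E ->
  exists A B, (hankel_rank f = ((\rank (hankel A B f))%:R)%:E) /\
    (\rank (hankel A B f) <= k)%N.
Proof.
move=> f_le.
have rank_le A B : (\rank (hankel A B f) <= k)%N.
  by have := le_trans (le_hankel_rank f A B) f_le; rewrite lee_fin ler_nat.
pose P n := `[< exists A B, \rank (hankel A B f) = n >].
have exP : exists n, P n.
  by exists (\rank (hankel fset0 fset0 f)); apply/asboolP; exists fset0, fset0.
have P_le n : P n -> (n <= k)%N by move=> /asboolP[A [B <-]].
case: (ex_maxnP exP P_le) => n /asboolP[A [B <-]] n_max.
exists A, B; split=> //; apply: le_anti; rewrite le_hankel_rank andbT.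
apply: ge_ereal_sup => _ [A' _ [B' _ <-]].
by rewrite lee_fin ler_nat n_max //; apply/asboolP; exists A', B'.
Qed.

(** In H_{A,A} = H(A, q) H(p, q)^-1 H(p, A) the middle factor is invertible, and
the outer ones have rank r because A contains Upsilon_k: the spanning property
is used for q and, with the roles of p and q exchanged, for p. *)
Lemma hankel_rank_Upsilon_sub (R : realType) (s : nat) (f : lattice s -> R[i]) k
    (A : {fset lattice s}) :
  (hankel_rank f <= (k%:R)%:E)%E -> {subset Upsilon s k <= A} ->
  ((\rank (hankel A A f))%:R)%:E = hankel_rank f.
Proof.
move=> f_le Upsilon_sub.
have [A0 [B0 []]] := hankel_rank_attained f_le.
set r := \rank _ => f_rank r_le.
have [p [q pq_unit]] : exists p q, @point_hankel _ s f r r p q \in unitmx.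
  have [g [h]] := unit_mxsub_rank (hankel A0 B0 f); rewrite -/r => gh_unit.
  exists (fun i => val (enum_val (g i))), (fun j => val (enum_val (h j))).
  rewrite (_ : point_hankel _ _ _ = mxsub g h (hankel A0 B0 f)) //.
  by apply/matrixP => i j; rewrite !mxE.
have rank_le m n (p' : 'I_m -> lattice s) (q' : 'I_n -> lattice s) :
    (\rank (point_hankel f p' q') <= r)%N.
  have [A' [B' [g [h ->]]]] := point_hankel_mxsub f p' q'.
  apply: leq_trans (mxrank_mxsub g h _) _.
  by have := le_hankel_rank f A' B'; rewrite f_rank lee_fin ler_nat.
have qp_unit : point_hankel f q p \in unitmx by rewrite -tr_point_hankel unitmx_tr.
have full p' q' : @point_hankel _ s f r r p' q' \in unitmx ->
    row_full (point_hankel f (@fset_point s A) q').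
  move=> pq'_unit; apply: (Upsilon_row_full pq'_unit rank_le r_le) => x.
  move=> /Upsilon_sub xA.
  apply: (eq_row_sub (enum_rank [` xA]%fset)).
  by rewrite row_point_hankel /fset_point enum_rankK.
rewrite f_rank hankelE (point_hankelE pq_unit rank_le) !mxrankMfree.
- by rewrite (eqP (full _ _ pq_unit)).
- by rewrite row_free_unit unitmx_inv.
- by rewrite /row_free -mxrank_tr tr_point_hankel; exact: full qp_unit.
Qed.

Theorem theorem2p4 (R : realType) (s : nat) (s_ge1 : (1 <= s)%N)
    (f : lattice s -> R[i]) :
  (hankel_rank f < +oo)%E ->
  forall k : nat, (hankel_rank f <= (k%:R)%:E)%E ->
    \rank (hankel (Gamma s k) (Gamma s k) f) =
      \rank (hankel (Upsilon s k) (Upsilon s k) f) /\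
    ((\rank (hankel (Upsilon s k) (Upsilon s k) f))%:R)%:E = hankel_rank f.
Proof.
move=> _ k f_le.
have Upsilon_rank := hankel_rank_Upsilon_sub f_le (fun _ => id).
have Gamma_rank := hankel_rank_Upsilon_sub f_le (@Upsilon_sub_Gamma s k).
split=> //; apply/eqP; rewrite -(eqr_nat R); apply/eqP.
by apply: EFin_inj; rewrite Gamma_rank Upsilon_rank.
Qed.
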